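(* Let $G$ be a $2\times2$ normal form game with a unique Nash equilibrium, which is completely mixed. Let $\beta\in(1/2,1)$, and let $\mu^*_\varepsilon$ be the unique invariant probability measure of the Recency Weighted Sampler with error parameter $\varepsilon>0$. Then there exists a constant $K>0$ such that for all $\varepsilon>0$ and $\eta>0$, $$\mu^*_\varepsilon\left(\{x\in\square(S):\ \|x-x^*\|_\infty\ge\eta\}\right)=O\!\left(\exp\!\left(-\frac{K\eta^2}{1-\beta}\right)\right)\qquad(\beta\to1),$$ where $x^*$ is the unique stationary point in $\square(S)$ of the mean-value process $$\dot x_i(t)=\mathbb{E}\left[\widetilde{BR}_i(x_{-i}(t))\right]-x_i(t),\qquad i=1,2.$$
   Context: Setting. $G$ is a finite two-player normal form game with roles $i\in\{1,2\}$ ($-i$ denotes the other role), pure strategy sets $S_1,S_2$ with $|S_i|=m_i$ (here $m_1=m_2=2$). $\Delta(S_i)$ is the set of mixed strategies, identified with the simplex of probability vectors in $\mathbb{R}^{m_i}$; $\square(S)=\Delta(S_1)\times\Delta(S_2)$. For $s\in S_i$, $\overrightarrow{1_{i,s}}\in\Delta(S_i)$ is the unit vector of the pure strategy $s$. For $\sigma\in\Delta(S_{-i})$, $BR_i(\sigma)\subset S_i$ is the set of pure best replies of player $i$ to $\sigma$. Parameters: sample size $k\in\mathbb{N}$, $k\ge1$ (fixed); recency parameter $\beta\in(0,1)$; error parameter $\varepsilon\in[0,1]$. Stochastic best reply. For $p\in\Delta(S_{-i})$, the random variable $\widetilde{BR}_i(p)\in S_i$ is generated as follows: draw $(n_s)_{s\in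 S_{-i}}$ from the multinomial distribution with parameters $k$ and $p$ and put $D=\frac1k\sum_{s\in S_{-i}}n_s\overrightarrow{1_{-i,s}}$; with probability $1-\varepsilon$ choose an element of $BR_i(D)$ uniformly at random; with probability $\varepsilon$ choose an element of $S_i$ uniformly at random. In expectations, $\widetilde{BR}_i(p)$ is identified with the corresponding unit vector, so $\mathbb{E}[\widetilde{BR}_i(p)]\in\Delta(S_i)$. Recency Weighted Sampler (RWS). It is the Markov chain $p(t)=(p_1(t),p_2(t))$ on $\square(S)$ with $p_i(t+1)=\beta p_i(t)+(1-\beta)\overrightarrow{1_{i,s_i(t)}}$, $s_i(t)=\widetilde{BR}_i(p_{-i}(t))$, where, given $p(t)$, the two players' draws are independent of each other. For $\varepsilon>0$ and $\beta>1/2$ (when $m_1=m_2=2$) it has a unique invariant probability measure $\mu^*_\varepsilon$. The stationary point $x^*$ depends on $k$ and $\varepsilon$ but not on $\beta$. *)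

(* Defs.v *)
From HB Require Import structures.
From mathcomp Require Import all_boot all_order all_algebra.
From mathcomp Require Import all_classical all_reals all_analysis.

Set Implicit Arguments.
Unset Strict Implicit.
Unset Printing Implicit Defensive.

Import Order.TTheory GRing.Theory Num.Theory.
Import numFieldNormedType.Exports.

Local Open Scope classical_set_scope.
Local Open Scope ring_scope.

(* Entry (s1, s2) of either matrix is the payoff of that player when player 1
   plays s1 and player 2 plays s2. *)
Record game (R : realType) (m1 m2 : nat) := Game {
  payoff1 : 'M[R]_(m1, m2) ;
  payoff2 : 'M[R]_(m1, m2) }.

(* Mixed strategies are row vectors and profiles are pairs of row vectors; the
   canonical norms on both are maximum norms, so `|x - y| is the l_infinity
   distance between the profiles x and y. *)
Definition profile (R : realType) (m1 m2 : nat) := ('rV[R]_m1 * 'rV[R]_m2)%type.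

Section OnePlayer.
Context {R : realType} {m l : nat}.

Definition simplex : set 'rV[R]_m :=
  [set p | (forall s, 0 <= p 0 s) /\ \sum_s p 0 s = 1].

Definition unit_vector (s : 'I_m) : 'rV[R]_m := delta_mx 0 s.

(* From here on A is the payoff matrix of the player under consideration, with
   her own strategies as rows and those of the opponent as columns: it is
   payoff1 G for player 1 and (payoff2 G)^T for player 2. *)
Implicit Type A : 'M[R]_(m, l).

Definition expected_payoff A (p : 'rV[R]_m) (q : 'rV[R]_l) : R :=
  \sum_(s < m) \sum_(t < l) p 0 s * q 0 t * A s t.

Definition best_replies A (q : 'rV[R]_l) : {set 'I_m} :=
  [set s | [forall s', expected_payoff A (unit_vector s') q
                       <= expected_payoff A (unit_vector s) q]]%SET.

End OnePlayer.

(* A sample of size k is recorded by the number of occurrences of each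
   strategy, a function c with \sum_s c s = k. *)
Section Sampling.
Context {R : realType} {m l : nat}.
Implicit Types (A : 'M[R]_(m, l)) (k : nat) (eps : R).

Definition multinomial_prob k (p : 'rV[R]_l) (c : {ffun 'I_l -> 'I_k.+1}) : R :=
  if (\sum_t c t)%N == k
  then (k`!)%:R / (\prod_t (c t)`!)%:R * \prod_t p 0 t ^+ c t
  else 0.

Definition empirical k (c : {ffun 'I_l -> 'I_k.+1}) : 'rV[R]_l :=
  k%:R^-1 *: \sum_t (c t)%:R *: unit_vector t.

(* Probability that the stochastic best reply to p is the pure strategy s. *)
Definition reply_prob A k eps (p : 'rV[R]_l) (s : 'I_m) : R :=
  \sum_(c : {ffun 'I_l -> 'I_k.+1}) multinomial_prob p c *
    let B := best_replies A (empirical c) in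
    ((1 - eps) * ((s \in B)%:R / #|B|%:R) + eps * m%:R^-1).

Definition expected_reply A k eps (p : 'rV[R]_l) : 'rV[R]_m :=
  \sum_s reply_prob A k eps p s *: unit_vector s.

End Sampling.

Section Game.
Context {R : realType} {m1 m2 : nat}.
Implicit Types (G : game R m1 m2) (x y : profile R m1 m2) (k : nat).
Implicit Types (eps beta : R).

Definition mixed_profiles : set (profile R m1 m2) := simplex `*` simplex.

Definition nash G : set (profile R m1 m2) := [set x | mixed_profiles x /\
  (forall p, simplex p -> expected_payoff (payoff1 G) p x.2
                          <= expected_payoff (payoff1 G) x.1 x.2) /\
  (forall q, simplex q -> expected_payoff (payoff2 G)^T q x.1
                          <= expected_payoff (payoff2 G)^T x.2 x.1)].

Definition completely_mixed x :=
  (forall s, 0 < x.1 0 s) /\ (forall s, 0 < x.2 0 s).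

(* Right-hand side of the mean-value process x' = mean_field x. *)
Definition mean_field G k eps x : profile R m1 m2 :=
  (expected_reply (payoff1 G) k eps x.2 - x.1,
   expected_reply (payoff2 G)^T k eps x.1 - x.2).

Definition stationary G k eps : set (profile R m1 m2) :=
  [set x | mixed_profiles x /\ mean_field G k eps x = 0].

(* The profiles with their Borel sigma-algebra. *)
Definition borel_profile := g_sigma_algebraType (@open (profile R m1 m2)).

Definition rws_next beta x (s1 : 'I_m1) (s2 : 'I_m2) : borel_profile :=
  (beta *: x.1 + (1 - beta) *: unit_vector s1,
   beta *: x.2 + (1 - beta) *: unit_vector s2).

(* One-step transition probability from x to U; the product of the two reply
   probabilities expresses that the players draw independently given x. *)
Definition rws_transition G k eps beta x (U : set borel_profile) : \bar R :=
  (\sum_(s1 < m1) \sum_(s2 < m2)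
     (reply_prob (payoff1 G) k eps x.2 s1
      * reply_prob (payoff2 G)^T k eps x.1 s2)%:E
     * \d_(rws_next beta x s1 s2) U)%E.

(* A probability measure on the state space mixed_profiles is represented by
   one on the ambient vector space that gives mass 1 to mixed_profiles. *)
Definition rws_invariant G k eps beta (mu : probability borel_profile R) :=
  mu mixed_profiles = 1%E /\
  forall U : set borel_profile, measurable U ->
    mu U = (\int[mu]_(x in mixed_profiles) rws_transition G k eps beta x U)%E.

Definition rws_unique_invariant G k eps beta (mu : probability borel_profile R) :=
  rws_invariant G k eps beta mu /\
  forall nu : probability borel_profile R, rws_invariant G k eps beta nu ->
    forall U : set borel_profile, measurable U -> nu U = mu U.

End Game.

Arguments borel_profile : clear implicits.

(* A name for the filter 1^'- of left neighbourhoods of 1, because the notation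
   =O_F cannot take a parenthesized F. *)
Notation one_left := (at_left 1).

(* Main.v *)
(** The share of each player's first strategy determines the state, and the
    expected replies to it are Bernstein polynomials in the opponent's share.
    Since the only Nash equilibrium is completely mixed, one of them is
    nondecreasing and the other nonincreasing, and both are Lipschitz with a
    constant L = k that does not depend on eps.  Hence there is only one
    stationary point, and half the squared distance to it plus L times the
    Bregman divergences of the antiderivatives of the two (signed) reply
    functions is a Lyapunov function W, with drift at most - 3/4 r^2 where r is
    the distance.  One step of the chain multiplies exp(lam W / h), h = 1 - beta,
    on average by at most exp(O(lam h)) (1 - lam r^2 / 2) for a fixed small lam
    depending only on L.  So its mean under the invariant measure is O(1 / h),
    and Markov's inequality gives the tail bound with K = lam / 4, the factor
    1 / h being absorbed by a part of the exponent. *)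
Require Import Defs.
From HB Require Import structures.
From mathcomp Require Import all_boot all_order all_algebra.
From mathcomp Require Import all_classical all_reals all_analysis.
From mathcomp Require Import measurable_realfun.
From mathcomp Require Import polyrcf ring lra.
Import Order.TTheory GRing.Theory Num.Theory.
Import numFieldNormedType.Exports.
Local Open Scope classical_set_scope.
Local Open Scope ring_scope.
Set Implicit Arguments.
Unset Strict Implicit.
Unset Printing Implicit Defensive.

(** * Bernstein polynomials with monotone coefficients *)

Section Bernstein.
Context {R : realType}.
Implicit Types (phi psi : nat -> R) (u v y c d : R) (p : {poly R}).

(* De Casteljau's recursion for the sum in [horner_bernstein]; it reduces
   monotonicity and the Lipschitz bound to an induction on [k]. *)
Fixpoint bernstein k phi : {poly R} :=
  if k is k'.+1 then
    'X * bernstein k' (fun j => phi j.+1) + (1 - 'X) * bernstein k' phi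
  else (phi 0)%:P.

Lemma horner_bernsteinS k phi y : (bernstein k.+1 phi).[y] =
  y * (bernstein k (fun j => phi j.+1)).[y] + (1 - y) * (bernstein k phi).[y].
Proof. by rewrite /= !hornerE. Qed.

Lemma horner_bernstein k phi y : (bernstein k phi).[y] =
  \sum_(j < k.+1) 'C(k, j)%:R * (y ^+ j * (1 - y) ^+ (k - j)) * phi j.
Proof.
elim: k phi => [|k IH] phi.
  by rewrite big_ord1 /= !hornerE.
rewrite horner_bernsteinS !IH [RHS]big_ord_recl /= bin0 mul1r.
under [X in _ = _ + X]eq_bigr => i _.
  rewrite /bump /= add1n binS natrD !mulrDl subSS.
  (* After Pascal's rule, one factor [1 - y] is pulled out. At [i = k] the truncated exponent
     [k - i.+1] does no harm, because ['C(k, k.+1)] is zero. *)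
  rewrite (_ : 'C(k, i.+1)%:R * _ * _ =
    (1 - y) * ('C(k, i.+1)%:R * (y ^+ i.+1 * (1 - y) ^+ (k - i.+1))
      * phi i.+1)); last first.
    have [ik|ki] := ltnP i k.
      by rewrite -(subnSK ik) [(1 - y) ^+ _.+1]exprS; ring.
    by rewrite bin_small ?ltnS// !mul0r mulr0.
  over.
rewrite big_split /= [RHS]addrA [LHS]addrC; congr (_ + _).
  rewrite [X in _ = _ + X]big_ord_recr /= bin_small// !mul0r mulr0 addr0.
  rewrite big_ord_recl /= mulrDr bin0 !subn0 [(1 - y) ^+ _.+1]exprS.
  by congr (_ + _); [ring|rewrite mulr_sumr].
by rewrite mulr_sumr; apply: eq_bigr => i _; rewrite exprS; ring.
Qed.

Lemma bernstein_affine k phi c d y :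
  (bernstein k (fun j => c * phi j + d)).[y] = c * (bernstein k phi).[y] + d.
Proof.
elim: k phi => [|k IH] phi; first by rewrite /= !hornerE.
by rewrite !horner_bernsteinS !IH; ring.
Qed.

Lemma bernstein_le k phi psi y : 0 <= y <= 1 -> (forall j, phi j <= psi j) ->
  (bernstein k phi).[y] <= (bernstein k psi).[y].
Proof.
move=> /andP[y0 y1]; elim: k phi psi => [|k IH] phi psi pp.
  by rewrite /= !hornerE.
by rewrite !horner_bernsteinS lerD// ler_wpM2l ?subr_ge0// IH.
Qed.

(** With [c = 0] this packs monotonicity and a Lipschitz bound on the unit interval into one
    hypothesis. *)
Definition slope_between (f : R -> R) c d := forall u v, 0 <= u -> u <= v ->
  v <= 1 -> c * (v - u) <= f v - f u <= d * (v - u).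

(** Let [S] and [T] be the polynomials of degree [k] for the shifted and the original coefficients.
    The increment from [u] to [v] in degree [k.+1] is [v (S(v) - S(u)) + (1 - v) (T(v) - T(u)) + (v
    - u) (S(u) - T(u))]. The first two terms average the inductive bounds, and
    [0 <= S(u) - T(u) <= 1] adds at most 1 to the slope. *)
Lemma bernstein_slope k phi : {homo phi : i j / (i <= j)%N >-> i <= j} ->
  (forall i j, phi i - phi j <= 1) ->
  slope_between (horner (bernstein k phi)) 0 k%:R.
Proof.
move=> + + u v u0 uv v1; elim: k phi => [|k IH] phi phiD phi1.
  by rewrite /= !hornerE subrr lexx.
have /andP[S0 S1] := IH (fun j => phi j.+1) (fun i j ij => phiD i.+1 j.+1 ij)
                        (fun i j => phi1 i.+1 j.+1).
have /andP[T0 T1] := IH phi phiD phi1.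
have ST0 : (bernstein k phi).[u] <= (bernstein k (fun j => phi j.+1)).[u].
  by apply: bernstein_le => [|j]; [rewrite u0 (le_trans uv)|exact: phiD].
have ST1 : (bernstein k (fun j => phi j.+1)).[u] <= (bernstein k phi).[u] + 1.
  rewrite -[X in _ <= X + 1]mul1r -bernstein_affine.
  apply: bernstein_le => [|j]; first by rewrite u0 (le_trans uv).
  by rewrite mul1r -lerBlDl.
rewrite !horner_bernsteinS -natr1; nra.
Qed.

End Bernstein.

(** * The Lyapunov function and its exponential drift *)

Section Lyapunov.
Context {R : realType}.
Implicit Types (p q P Q : {poly R}) (u v x y z : R).

(** From [exp(-z) >= 1 - z] one gets [exp(z) <= 1 / (1 - z)], and [(1 + z + 2 z^2) (1 - z) = 1 + z^2
    (1 - 2 z) >= 1]. *)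
Lemma expR_le1DxDsqr z : z <= 2^-1 -> expR z <= 1 + z + 2 * z ^+ 2.
Proof.
move=> z2; have z1 : 0 < 1 - z by lra.
have : expR z <= (1 - z)^-1.
  rewrite -[leLHS]invrK -expRN lef_pV2 ?posrE ?expR_gt0//.
  exact: expR_ge1Dx.
move=> /le_trans; apply; rewrite -div1r ler_pdivrMr//.
have := sqr_ge0 z; nra.
Qed.

Lemma slope_between_ge0 (f : R -> R) L : slope_between f 0 L -> 0 <= L.
Proof. by move=> fL; have /andP[] := fL 0 1 (lexx _) ler01 (lexx _); lra. Qed.

Lemma slope_between_monotone (f : R -> R) L u v : slope_between f 0 L ->
  0 <= u <= 1 -> 0 <= v <= 1 -> 0 <= (v - u) * (f v - f u).
Proof.
move=> fL /andP[u0 u1] /andP[v0 v1]; have [uv|/ltW vu] := leP u v.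
  have /andP[c0 _] := fL u v u0 uv v1.
  by rewrite mulr_ge0//; lra.
have /andP[c0 _] := fL v u v0 vu u1.
by rewrite -mulrNN mulr_ge0//; lra.
Qed.

(** Co-coercivity of a monotone Lipschitz function: the first bound lets the drift absorb squared
    differences of replies. *)
Lemma slope_between_sqr (f : R -> R) L u v : slope_between f 0 L ->
  0 <= u <= 1 -> 0 <= v <= 1 -> (f v - f u) ^+ 2 <= L * ((v - u) * (f v - f u))
   /\ L * ((v - u) * (f v - f u)) <= L ^+ 2 * (v - u) ^+ 2.
Proof.
move=> fL; have L0 := slope_between_ge0 fL; move=> /andP[u0 u1] /andP[v0 v1].
have [uv|/ltW vu] := leP u v.
  have /andP[c0 cL] := fL u v u0 uv v1; split; first by nra.
  have : (v - u) * (f v - f u) <= L * (v - u) ^+ 2 by nra.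
  by move=> /(ler_wpM2l L0)/le_trans -> //; rewrite mulrA -expr2.
have /andP[c0 cL] := fL v u v0 vu u1; split; first by nra.
have : (v - u) * (f v - f u) <= L * (v - u) ^+ 2 by nra.
by move=> /(ler_wpM2l L0)/le_trans -> //; rewrite mulrA -expr2.
Qed.

Lemma sqrB_le1 u v : 0 <= u <= 1 -> 0 <= v <= 1 -> (u - v) ^+ 2 <= 1.
Proof.
by move=> ? ?; rewrite -real_normK ?num_real// expr_le1// ler_norml; lra.
Qed.

Lemma poly_antiderivative p : exists P, P^`() = p.
Proof.
exists (\poly_(i < (size p).+1) (p`_i.-1 / i%:R)); apply/polyP => i.
rewrite coef_deriv coef_poly ltnS /=; case: ltnP => pi.
  by rewrite -[LHS]mulr_natr divfK ?pnatr_eq0.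
by rewrite mul0rn nth_default.
Qed.

Definition bregman P u v := P.[v] - P.[u] - P^`().[u] * (v - u).

(** By the mean value theorem the divergence is [(P'(c) - P'(u)) (v - u)] with [c] between [u] and
    [v]. Monotonicity of [P'] gives both factors the same sign, and [c] is no farther from [u] than
    [v] is. *)
Lemma bregman_ge0_le P L u v : slope_between (horner P^`()) 0 L ->
  0 <= u <= 1 -> 0 <= v <= 1 -> 0 <= bregman P u v <= L * (v - u) ^+ 2.
Proof.
move=> PL /andP[u0 u1] /andP[v0 v1]; rewrite /bregman.
have L0 := slope_between_ge0 PL.
have [uv|vu|->] := ltgtP u v; last by rewrite !subrr expr0n /= !mulr0 subrr lexx.
- have [c] := poly_mvt P uv; rewrite in_itv /= => /andP[uc cv] ->.
  have := PL u c u0 (ltW uc) (ltW (lt_le_trans cv v1)).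
  rewrite mul0r -mulrBl => /andP[c0 cL].
  have uv0 : 0 <= v - u by rewrite subr_ge0 ltW.
  apply/andP; split; first exact: mulr_ge0.
  rewrite expr2 mulrA; rewrite ler_wpM2r// (le_trans cL)// ler_wpM2l//; lra.
- have [c] := poly_mvt P vu; rewrite in_itv /= => /andP[vc cu] e.
  have -> : P.[v] - P.[u] = P^`().[c] * (v - u) by rewrite -opprB e; ring.
  have := PL c u (ltW (le_lt_trans v0 vc)) (ltW cu) u1.
  rewrite mul0r -mulrBl -[(_ - _) * (v - u)]mulrNN !opprB => /andP[c0 cL].
  have vu0 : 0 <= u - v by rewrite subr_ge0 ltW.
  apply/andP; split; first exact: mulr_ge0.
  rewrite -[_ ^+ 2]sqrrN opprB expr2 mulrA.
  by rewrite ler_wpM2r// (le_trans cL)// ler_wpM2l//; lra.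
Qed.

(* The expected replies are [s * p] and [- s * q], where the sign [s] tells which
   of the two players wants to match the other one. *)
Variables (P Q : {poly R}) (L s xs ys : R).
Local Notation p := P^`().
Local Notation q := Q^`().
Hypotheses (pL : slope_between (horner p) 0 L)
           (qL : slope_between (horner q) 0 L).
Hypotheses (s2 : s ^+ 2 = 1) (xsE : xs = s * p.[ys]) (ysE : ys = - s * q.[xs]).
Hypotheses (xs01 : 0 <= xs <= 1) (ys01 : 0 <= ys <= 1).

(* The quadratic term alone is not a Lyapunov function; the Bregman divergences
   of the antiderivatives of the (signed) reply functions cancel the cross
   terms in its derivative. *)
Definition lyapunov x y := ((x - xs) ^+ 2 + (y - ys) ^+ 2) / 2
  + L * (bregman P ys y + bregman Q xs x).

(** The derivative of [lyapunov] at [(x, y)] in the direction [(d, e)]. *)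
Definition lyapunov_slope x y d e :=
  (x - xs + L * (q.[x] - q.[xs])) * d + (y - ys + L * (p.[y] - p.[ys])) * e.

(** Not the sample size: a convenient bound for [1/2 + L^2], the second-order constant of
    [lyapunov]. *)
Let k := 1 + L ^+ 2.
Local Notation r2 x y := ((x - xs) ^+ 2 + (y - ys) ^+ 2).

Let L0 : 0 <= L. Proof. exact: slope_between_ge0 pL. Qed.

Lemma lyapunov_ge_le x y : 0 <= x <= 1 -> 0 <= y <= 1 ->
  r2 x y / 2 <= lyapunov x y <= k * r2 x y.
Proof.
move=> x01 y01.
have /andP[by0 byL] := bregman_ge0_le pL ys01 y01.
have /andP[bx0 bxL] := bregman_ge0_le qL xs01 x01.
rewrite /lyapunov /k; apply/andP; split.
  by rewrite lerDl mulr_ge0// addr_ge0.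
have : L * (bregman P ys y + bregman Q xs x) <= L * (L * r2 x y).
  by rewrite ler_wpM2l//; lra.
have := sqr_ge0 (x - xs); have := sqr_ge0 (y - ys); lra.
Qed.

(** The three-point identity of Bregman divergences makes the remainder after the linear term
    exactly half the squared step plus [L] times the divergences between the old and the new
    point. *)
Lemma lyapunov_step x y x' y' : 0 <= x <= 1 -> 0 <= y <= 1 ->
  0 <= x' <= 1 -> 0 <= y' <= 1 ->
  lyapunov x' y' <= lyapunov x y + lyapunov_slope x y (x' - x) (y' - y)
     + k * ((x' - x) ^+ 2 + (y' - y) ^+ 2).
Proof.
move=> x01 y01 x'01 y'01.
have /andP[_ byL] := bregman_ge0_le pL y01 y'01.
have /andP[_ bxL] := bregman_ge0_le qL x01 x'01.
have -> : lyapunov x' y' = lyapunov x y + lyapunov_slope x y (x' - x) (y' - y)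
   + ((x' - x) ^+ 2 + (y' - y) ^+ 2) / 2
   + L * (bregman P y y' + bregman Q x x').
  by rewrite /lyapunov /lyapunov_slope /bregman; field.
have : L * (bregman P y y' + bregman Q x x')
   <= L * (L * ((x' - x) ^+ 2 + (y' - y) ^+ 2)).
  by rewrite ler_wpM2l//; lra.
rewrite /k; have := sqr_ge0 (x' - x); have := sqr_ge0 (y' - y); lra.
Qed.

(** With deviations [a], [b] and reply differences [F], [H], the terms [L s F H] cancel because the
    players' signs are opposite. Young's inequality bounds [s (a F - b H)] by
    [(a^2 + b^2) / 4 + F^2 + H^2], and by co-coercivity the remaining [- L (b F + a H)] cancels
    [F^2 + H^2]. *)
Lemma lyapunov_drift x y : 0 <= x <= 1 -> 0 <= y <= 1 ->
  lyapunov_slope x y (s * p.[y] - x) (- s * q.[x] - y) <= - (3 / 4) * r2 x y.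
Proof.
move=> x01 y01.
have [] := slope_between_sqr pL ys01 y01; have [] := slope_between_sqr qL xs01 x01.
rewrite /lyapunov_slope.
set F := p.[y] - p.[ys]; set H := q.[x] - q.[xs] => H1 _ F1 _.
have -> : s * p.[y] - x = s * F - (x - xs) by rewrite xsE /F; ring.
have -> : - s * q.[x] - y = - s * H - (y - ys) by rewrite [in RHS]ysE /H; ring.
set a := x - xs in H1 *; set b := y - ys in F1 *.
have -> : (a + L * H) * (s * F - a) + (b + L * F) * (- s * H - b) =
  - a ^+ 2 - b ^+ 2 + (a * (s * F) - b * (s * H))
  - (L * (b * F) + L * (a * H)) by ring.
have HF : a * (s * F) <= a ^+ 2 / 4 + F ^+ 2.
  have : 0 <= (a / 2 - s * F) ^+ 2 by exact: sqr_ge0.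
  rewrite sqrrB !exprMn s2; lra.
have HH : - (b * (s * H)) <= b ^+ 2 / 4 + H ^+ 2.
  have : 0 <= (b / 2 + s * H) ^+ 2 by exact: sqr_ge0.
  rewrite sqrrD !exprMn s2; lra.
lra.
Qed.

(** Controls the quadratic term in the expansion of the exponential. Since replies are
    [L]-Lipschitz, each partial derivative is at most [k] times the deviation in its coordinate. *)
Lemma lyapunov_slope_sqr x y d e : 0 <= x <= 1 -> 0 <= y <= 1 ->
  `|d| <= 1 -> `|e| <= 1 ->
  lyapunov_slope x y d e ^+ 2 <= 2 * k ^+ 2 * r2 x y.
Proof.
move=> x01 y01 d1 e1.
have [F1 F2] := slope_between_sqr pL ys01 y01.
have [H1 H2] := slope_between_sqr qL xs01 x01.
rewrite /lyapunov_slope.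
set F := p.[y] - p.[ys] in F1 F2 *; set H := q.[x] - q.[xs] in H1 H2 *.
set a := x - xs in H1 H2 *; set b := y - ys in F1 F2 *.
have A2 : (a + L * H) ^+ 2 <= k ^+ 2 * a ^+ 2.
  rewrite sqrrD exprMn /k.
  have : L ^+ 2 * H ^+ 2 <= L ^+ 2 * (L ^+ 2 * a ^+ 2).
    by rewrite ler_wpM2l ?sqr_ge0//; lra.
  rewrite -mulr_natl; lra.
have B2 : (b + L * F) ^+ 2 <= k ^+ 2 * b ^+ 2.
  rewrite sqrrD exprMn /k.
  have : L ^+ 2 * F ^+ 2 <= L ^+ 2 * (L ^+ 2 * b ^+ 2).
    by rewrite ler_wpM2l ?sqr_ge0//; lra.
  rewrite -mulr_natl; lra.
have d2 : d ^+ 2 <= 1 by rewrite -real_normK ?num_real ?expr_le1.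
have e2 : e ^+ 2 <= 1 by rewrite -real_normK ?num_real ?expr_le1.
set A := a + L * H in A2 *; set B := b + L * F in B2 *.
have Ad : (A * d) ^+ 2 <= A ^+ 2.
  by rewrite exprMn ler_piMr ?sqr_ge0.
have Be : (B * e) ^+ 2 <= B ^+ 2.
  by rewrite exprMn ler_piMr ?sqr_ge0.
have : 0 <= (A * d - B * e) ^+ 2 by exact: sqr_ge0.
rewrite sqrrB sqrrD; lra.
Qed.

(** Chosen so that the quadratic error [2 (lam Z)^2] is at most [lam / 4] times [r2]. Of the drift
    [- 3/4 lam r2] this leaves [- lam / 2 r2]. *)
Definition lyapunov_rate := (16 * k ^+ 2)^-1.

Local Notation lam := lyapunov_rate.

Let k1 : 1 <= k. Proof. by rewrite lerDl sqr_ge0. Qed.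

Let lam0 : 0 < lam.
Proof. by rewrite invr_gt0 mulr_gt0// exprn_gt0// (lt_le_trans ltr01). Qed.

Let lamk : lam * k ^+ 2 = 16^-1.
Proof.
by rewrite /lyapunov_rate invfM divfK// expf_neq0// gt_eqF// (lt_le_trans ltr01).
Qed.

Definition lyapunov_exp beta x y := expR (lam / (1 - beta) * lyapunov x y).

(** The bound is affine in [d] and [e] separately and without a product of the two, so that
    averaging over the replies merely replaces them by their means. *)
Lemma lyapunov_exp_step beta x y d e : 0 <= beta < 1 ->
  0 <= x <= 1 -> 0 <= y <= 1 -> 0 <= d <= 1 -> 0 <= e <= 1 ->
  lyapunov_exp beta (beta * x + (1 - beta) * d) (beta * y + (1 - beta) * e)
  <= lyapunov_exp beta x y * expR (2 * lam * k * (1 - beta)) *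
     (1 + lam * lyapunov_slope x y (d - x) (e - y) + lam / 4 * r2 x y).
Proof.
move=> /andP[b0 b1] x01 y01 d01 e01; set h := 1 - beta.
have [h0 h1] : 0 < h /\ h <= 1 by rewrite /h; split; lra.
have convex01 u v : 0 <= u <= 1 -> 0 <= v <= 1 -> 0 <= beta * u + h * v <= 1.
  move=> /andP[u0 u1] /andP[v0 v1]; apply/andP; split.
    by rewrite addr_ge0// mulr_ge0// ltW.
  have := ler_wpM2l b0 u1; have := ler_wpM2l (ltW h0) v1; rewrite /h; lra.
set Z := lyapunov_slope x y (d - x) (e - y).
have dx1 : `|d - x| <= 1 by rewrite ler_norml; lra.
have ey1 : `|e - y| <= 1 by rewrite ler_norml; lra.
have Z2 := lyapunov_slope_sqr x01 y01 dx1 ey1.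
have lamZ2 : 2 * (lam * Z) ^+ 2 <= lam / 4 * r2 x y.
  rewrite exprMn; apply: (@le_trans _ _ (2 * (lam ^+ 2 * (2 * k ^+ 2 * r2 x y)))).
    by rewrite ler_pM2l// ler_wpM2l// sqr_ge0.
  rewrite [leLHS](_ : _ = 4 * lam * (lam * k ^+ 2) * r2 x y); last by ring.
  by rewrite lamk; lra.
(* From [r2 <= 2] and [lam <= 1/16], [lamZ2] gives [(lam Z)^2 <= 1/64], which puts [lam * Z] in the
   range of [expR_le1DxDsqr]. *)
have lamZ : lam * Z <= 2^-1.
  have lam1 : lam <= 16^-1.
    by rewrite -lamk ler_peMr ?(ltW lam0)// expr_ge1// (le_trans ler01).
  have r22 : r2 x y <= 2.
    by have := sqrB_le1 x01 xs01; have := sqrB_le1 y01 ys01; lra.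
  have : lam / 4 * r2 x y <= 16^-1 / 4 * 2.
    by rewrite ler_pM ?ler_pM2r ?addr_ge0 ?sqr_ge0// divr_ge0// ltW.
  nra.
have -> : lyapunov_exp beta x y * expR (2 * lam * k * h) *
     (1 + lam * Z + lam / 4 * r2 x y) =
   lyapunov_exp beta x y * (expR (2 * lam * k * h) *
     (1 + lam * Z + lam / 4 * r2 x y)) by ring.
apply: (@le_trans _ _ (lyapunov_exp beta x y *
    (expR (2 * lam * k * h) * expR (lam * Z)))); last first.
  rewrite ler_pM2l ?expR_gt0// ler_pM2l ?expR_gt0//.
  by rewrite (le_trans (expR_le1DxDsqr lamZ))// lerD2l.
rewrite -!expRD ler_expR -/h.
have := lyapunov_step x01 y01 (convex01 _ _ x01 d01) (convex01 _ _ y01 e01).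
have dxE : beta * x + h * d - x = h * (d - x) by rewrite /h; ring.
have eyE : beta * y + h * e - y = h * (e - y) by rewrite /h; ring.
rewrite dxE eyE.
have -> : lyapunov_slope x y (h * (d - x)) (h * (e - y)) = h * Z.
  by rewrite /Z /lyapunov_slope; ring.
set W := lyapunov x y; set W' := lyapunov _ _ => W'W.
(* Each coordinate moves by at most [h]. After scaling by [lam / h] the last term becomes the
   exponent [2 lam k h]. *)
have {}W'W : W' <= W + h * Z + k * (2 * h ^+ 2).
  apply: (le_trans W'W); rewrite lerD2l ler_wpM2l ?(le_trans ler01)//.
  have d1 := sqrB_le1 d01 x01; have e1 := sqrB_le1 e01 y01.
  rewrite !exprMn -mulrDr [leRHS]mulrC ler_pM2l ?exprn_gt0//; lra.
apply: (le_trans (ler_wpM2l (divr_ge0 (ltW lam0) (ltW h0)) W'W)).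
by rewrite le_eqVlt; apply/orP; left; apply/eqP; field; rewrite gt_eqF.
Qed.

(** A geometric drift condition for one step of the chain, in which [w1] and [w2] are the
    probabilities of the first strategies. Far from the stationary point the drift beats the noise
    and the function contracts; near it the function itself is bounded independently of [beta]. *)
Lemma lyapunov_exp_drift beta x y (w1 : R := s * p.[y]) (w2 : R := - s * q.[x])
  (E := fun d e : R =>
    lyapunov_exp beta (beta * x + (1 - beta) * d) (beta * y + (1 - beta) * e)) :
  0 <= beta < 1 -> 0 <= x <= 1 -> 0 <= y <= 1 -> 0 <= w1 <= 1 -> 0 <= w2 <= 1 ->
  w1 * w2 * E 1 1 + w1 * (1 - w2) * E 1 0 +
  ((1 - w1) * w2 * E 0 1 + (1 - w1) * (1 - w2) * E 0 0) <=
  expR (- (lam * (1 - beta))) * lyapunov_exp beta x y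
  + expR (lam * (4 * k * (k + 1))).
Proof.
move=> b01 x01 y01 /andP[w10 w11] /andP[w20 w21]; set h := 1 - beta.
have /andP[b0 b1] := b01.
have [h0 h1] : 0 < h /\ h <= 1 by rewrite /h; split; lra.
set V := lyapunov_exp beta x y; set X := expR (2 * lam * k * h).
have V0 : 0 < V by exact: expR_gt0.
have X0 : 0 < X by exact: expR_gt0.
set Z := lyapunov_slope x y.
have o1 : 0 <= (1 : R) <= 1 by rewrite ler01 lexx.
have z1 : 0 <= (0 : R) <= 1 by rewrite ler01 lexx.
have EZ d e : 0 <= d <= 1 -> 0 <= e <= 1 ->
    E d e <= V * X * (1 + lam * Z (d - x) (e - y) + lam / 4 * r2 x y).
  by move=> d01 e01; exact: lyapunov_exp_step.
have sumE : w1 * w2 * E 1 1 + w1 * (1 - w2) * E 1 0 +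
  ((1 - w1) * w2 * E 0 1 + (1 - w1) * (1 - w2) * E 0 0) <=
  V * X * (1 + lam * Z (w1 - x) (w2 - y) + lam / 4 * r2 x y).
  have w1' : 0 <= 1 - w1 by rewrite subr_ge0.
  have w2' : 0 <= 1 - w2 by rewrite subr_ge0.
  have := ler_wpM2l (mulr_ge0 w10 w20) (EZ _ _ o1 o1).
  have := ler_wpM2l (mulr_ge0 w10 w2') (EZ _ _ o1 z1).
  have := ler_wpM2l (mulr_ge0 w1' w20) (EZ _ _ z1 o1).
  have := ler_wpM2l (mulr_ge0 w1' w2') (EZ _ _ z1 z1).
  move=> e1 e2 e3 e4.
  apply: (le_trans (lerD (lerD e4 e3) (lerD e2 e1))).
  rewrite le_eqVlt; apply/orP; left; apply/eqP.
  by rewrite /Z /lyapunov_slope; ring.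
apply: (le_trans sumE).
have {}sumE : 1 + lam * Z (w1 - x) (w2 - y) + lam / 4 * r2 x y
    <= expR (- (lam / 2 * r2 x y)).
  apply: le_trans (expR_ge1Dx _).
  have := ler_wpM2l (ltW lam0) (lyapunov_drift x01 y01); rewrite -/Z -/w1 -/w2.
  lra.
have VX0 : 0 <= V * X by rewrite mulr_ge0// ltW.
apply: (le_trans (ler_wpM2l VX0 sumE)) => {sumE}.
(* This threshold is where [2 lam k h - lam / 2 r2] drops to [- lam h]. *)
have [r_big|r_small] := leP (2 * (2 * k + 1) * h) (r2 x y).
  rewrite -[leLHS]addr0; apply: lerD; last exact: expR_ge0.
  rewrite -[leLHS]mulrA [leRHS]mulrC ler_pM2l//.
  rewrite -expRD ler_expR.
  have := ler_wpM2l (ltW lam0) r_big; lra.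
rewrite -[leLHS]add0r; apply: lerD; first by rewrite mulr_ge0 ?expR_ge0.
rewrite -!expRD ler_expR.
have /andP[_ Wk] := lyapunov_ge_le x01 y01.
(* Here [lyapunov <= k r2] is of order [h], which cancels the [1 / h]. Adding the noise exponent, at
   most [2 lam k], gives [lam * (4 * k * (k + 1))]. *)
have : lam / h * lyapunov x y <= lam * (2 * k * (2 * k + 1)).
  rewrite -mulrA ler_pM2l// mulrC ler_pdivrMr// (le_trans Wk)//.
  rewrite [leRHS](_ : _ = k * (2 * (2 * k + 1) * h)); last by ring.
  by rewrite ler_pM2l ?(lt_le_trans ltr01)// ltW.
have : 0 <= lam / 2 * r2 x y by rewrite mulr_ge0 ?addr_ge0 ?sqr_ge0 ?divr_ge0// ltW.
have : 2 * lam * k * h <= 2 * lam * k.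
  by rewrite ler_piMr// !mulr_ge0 ?(ltW lam0)// (le_trans ler01).
rewrite /h; lra.
Qed.

End Lyapunov.

(** * Sampled best replies with two strategies *)

Section TwoStrategies.
Context {R : realType}.
Implicit Types (A : 'M[R]_2) (p q : 'rV[R]_2) (eps y d : R).

Lemma simplex2P q : simplex q <-> 0 <= q 0 0 <= 1 /\ q 0 1 = 1 - q 0 0.
Proof.
rewrite /simplex /= big_ord_recl big_ord1 -[lift _ _]/(lift 0 0 : 'I_2).
have -> : lift 0 0 = 1 :> 'I_2 by exact/val_inj.
split=> [[q0 q1]|[/andP[q0 q1] q1E]].
  by have := q0 0; have := q0 1; split; lra.
split=> [i|]; last by rewrite q1E addrC subrK.
have [->//|] := eqVneq i 0.
have [-> _|i1 i0] := eqVneq i 1; first by rewrite q1E subr_ge0.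
by case: i i1 i0 => [[|[|]]].
Qed.

Lemma ord2E (i : 'I_2) : (i == 0) || (i == 1).
Proof. by case: i => [[|[|]]]. Qed.

Lemma sum2 (V : nmodType) (F : 'I_2 -> V) : \sum_i F i = F 0 + F 1.
Proof.
rewrite big_ord_recl big_ord1; congr (_ + F _); exact/val_inj.
Qed.

Lemma sum2n (F : 'I_2 -> nat) : (\sum_i F i)%N = (F 0%R + F 1%R)%N.
Proof. exact: sum2. Qed.

(** The payoff gain of the first strategy over the second when the opponent's first strategy has
    probability [y]; [advantage_slope] is its derivative in [y]. *)
Definition advantage A y : R := y * (A 0 0 - A 1 0) + (1 - y) * (A 0 1 - A 1 1).

Definition advantage_slope A : R := (A 0 0 - A 1 0) - (A 0 1 - A 1 1).

Lemma expected_payoff2 A p q : simplex p -> simplex q ->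
  expected_payoff A p q
  = (q 0 0 * A 1 0 + q 0 1 * A 1 1) + p 0 0 * advantage A (q 0 0).
Proof.
move=> /simplex2P[_ p1] /simplex2P[_ q1].
by rewrite /expected_payoff !sum2 /advantage p1 q1; ring.
Qed.

Lemma unit_vector2 (s : 'I_2) :
  @unit_vector R 2 s 0 0 = (s == 0)%:R /\ @unit_vector R 2 s 0 1 = (s == 1)%:R.
Proof. by rewrite /unit_vector !mxE !eqxx ![_ == s]eq_sym. Qed.

Lemma simplex_unit_vector (s : 'I_2) : simplex (@unit_vector R 2 s).
Proof.
apply/simplex2P; have [-> ->] := unit_vector2 s.
by have /orP[/eqP->|/eqP->] := ord2E s; rewrite /= ?ler01 ?lexx ?subrr ?subr0.
Qed.

(** The probability of the first strategy in a uniform choice among best replies, as a function of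
    its advantage. *)
Definition best_reply_weight d : R := if d == 0 then 2^-1 else (0 < d)%R%:R.

Lemma best_replies2 A q (B := best_replies A q) : simplex q ->
  (0 \in B)%:R / #|B|%:R = best_reply_weight (advantage A (q 0 0)) /\
  (1 \in B)%:R / #|B|%:R = 1 - best_reply_weight (advantage A (q 0 0)).
Proof.
move=> sq; set d := advantage _ _.
set u := fun s => expected_payoff A (unit_vector s) q.
have u01 : u 0 = u 1 + d.
  rewrite /u !expected_payoff2 //; [|exact: simplex_unit_vector..].
  by rewrite !(unit_vector2 _).1 /= mul1r mul0r addr0.
have inB s : (s \in B) = (u 0 <= u s) && (u 1 <= u s).
  rewrite inE; apply/forallP/andP => [uB|[u0 u1] s']; first by split; exact: uB.
  by have /orP[/eqP->|/eqP->] := ord2E s'.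
have B0 : (0 \in B) = (0 <= d) by rewrite inB lexx u01 lerDl.
have B1 : (1 \in B) = (d <= 0) by rewrite inB lexx u01 gerDl andbT.
have cB : #|B|%:R = (0 \in B)%:R + (1 \in B)%:R :> R.
  by rewrite -sum1_card natr_sum big_mkcond /= sum2; do 2 case: (_ \in B).
rewrite cB B0 B1 /best_reply_weight.
have h2 : 1 + 1 = 2 :> R by [].
by have [d0|d0|d0] := ltgtP d 0; rewrite /= ?mulr0n ?mulr1n
  ?mul0r ?add0r ?addr0 ?divr1 ?h2; split; lra.
Qed.

Definition split_sample k (j : 'I_k.+1) : {ffun 'I_2 -> 'I_k.+1} :=
  [ffun t => if t == 0 then j else rev_ord j].

Lemma split_sample1 k (j : 'I_k.+1) : split_sample j 1 = (k - j)%N :> nat.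
Proof. by rewrite ffunE. Qed.

Lemma split_sample0 k (j : 'I_k.+1) : split_sample j 0 = j.
Proof. by rewrite ffunE. Qed.

(** Only counts with total [k] have positive weight, and these are determined by the count of the
    first strategy: the multinomial law becomes binomial. *)
Lemma sum_multinomial2 k q (F : {ffun 'I_2 -> 'I_k.+1} -> R) :
  \sum_c multinomial_prob q c * F c =
  \sum_(j < k.+1) 'C(k, j)%:R * (q 0 0 ^+ j * q 0 1 ^+ (k - j))
                  * F (split_sample j).
Proof.
rewrite (bigID (fun c : {ffun 'I_2 -> 'I_k.+1} => (\sum_t c t)%N == k)) /=.
rewrite [X in _ + X]big1 ?addr0; last first.
  by move=> c /negPf ck; rewrite /multinomial_prob ck mul0r.
rewrite (reindex_onto (@split_sample k) (fun c => c 0)); last first.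
  move=> c /eqP; rewrite sum2n => ck; apply/ffunP => t.
  have /orP[/eqP->|/eqP->] := ord2E t; first by rewrite split_sample0.
  apply: ord_inj; rewrite split_sample1; apply/eqP.
  have c0k : (c 0%R <= k)%N by rewrite -ltnS.
  by rewrite -(eqn_add2l (c 0%R)) subnKC ?ck.
apply: eq_big => [j|j _].
  by rewrite sum2n split_sample1 split_sample0 eqxx andbT subnKC ?eqxx// -ltnS.
have jk : (j <= k)%N by rewrite -ltnS.
rewrite /multinomial_prob sum2n split_sample1 split_sample0 subnKC// eqxx.
congr (_ * _); rewrite !big_ord_recl !big_ord0 !muln1 !mulr1.
have -> : lift 0 0 = 1 :> 'I_2 by exact/val_inj.
rewrite split_sample1 split_sample0; congr (_ * _).
by rewrite -(bin_fact jk) natrM mulfK// pnatr_eq0 -lt0n muln_gt0 !fact_gt0.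
Qed.

Lemma empirical_split_sample k (j : 'I_k.+1) : (0 < k)%N ->
  simplex (@empirical R 2 k (split_sample j)) /\
  @empirical R 2 k (split_sample j) 0 0 = j%:R / k%:R.
Proof.
move=> k0; have jk : (j <= k)%N by rewrite -ltnS.
have k0R : 0 < k%:R :> R by rewrite ltr0n.
have e0 : @empirical R 2 k (split_sample j) 0 0 = j%:R / k%:R.
  rewrite /empirical sum2 !mxE /= split_sample0; lra.
split=> //; apply/simplex2P; rewrite e0; split.
  by rewrite divr_ge0//= ler_pdivrMr// mul1r ler_nat.
rewrite /empirical sum2 !mxE /= split_sample1 natrB//.
by field; rewrite gt_eqF.
Qed.

(** Defined for all natural [j], also above [k], so that monotonicity and the bounds hold on all of
    [nat], as [bernstein_slope] requires. *)
Definition reply_weight A k eps (j : nat) : R :=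
  (1 - eps) * best_reply_weight (advantage A (j%:R / k%:R)) + eps / 2.

Lemma reply_prob2 A k eps q : (0 < k)%N -> simplex q ->
  reply_prob A k eps q 0 = (bernstein k (reply_weight A k eps)).[q 0 0] /\
  reply_prob A k eps q 1 = 1 - (bernstein k (reply_weight A k eps)).[q 0 0].
Proof.
move=> k0 /simplex2P[_ q1]; rewrite /reply_prob /= !sum_multinomial2 q1.
split.
  rewrite horner_bernstein; apply: eq_bigr => j _.
  have [se e0] := empirical_split_sample j k0.
  by rewrite (best_replies2 _ se).1 e0.
rewrite [RHS](_ : _ = -1 * (bernstein k (reply_weight A k eps)).[q 0 0] + 1); last first.
  by rewrite mulN1r addrC.
rewrite -bernstein_affine horner_bernstein; apply: eq_bigr => j _.
have [se e0] := empirical_split_sample j k0.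
by rewrite (best_replies2 _ se).2 e0 /reply_weight; congr (_ * _); field.
Qed.

Lemma best_reply_weight_homo : {homo best_reply_weight : d e / d <= e}.
Proof.
move=> d e de; rewrite /best_reply_weight.
by have [d0|d0|d0] := ltgtP d 0; have [e0|e0|e0] := ltgtP e 0 => /=; lra.
Qed.

Lemma best_reply_weight01 d : 0 <= best_reply_weight d <= 1.
Proof. by rewrite /best_reply_weight; case: ltgtP => /= _; lra. Qed.

Lemma reply_weight01 A k eps j : 0 <= eps <= 1 -> 0 <= reply_weight A k eps j <= 1.
Proof.
move=> e01; have := best_reply_weight01 (advantage A (j%:R / k%:R)).
rewrite /reply_weight; nra.
Qed.

Lemma bernstein01 k (phi : nat -> R) y : (forall j, 0 <= phi j <= 1) ->
  0 <= y <= 1 -> 0 <= (bernstein k phi).[y] <= 1.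
Proof.
move=> phi01 y01.
have b1 c : c = (bernstein k (fun=> c)).[y].
  by have := bernstein_affine k (fun=> 0) 0 c y; rewrite !mul0r !add0r.
rewrite [leLHS]b1 [X in _ && (_ <= X)]b1 !bernstein_le// => j.
  by have /andP[] := phi01 j.
by have /andP[] := phi01 j.
Qed.

(** The reply weights jump, so the Lipschitz bound comes from sampling: they are monotone with
    oscillation at most 1, whatever [eps] is. *)
Lemma bernstein_reply_slope A k eps s : 0 <= eps <= 1 -> s ^+ 2 = 1 ->
  0 <= s * advantage_slope A ->
  slope_between (horner (bernstein k (fun j => s * reply_weight A k eps j)))
    0 k%:R.
Proof.
move=> e01 s21 sA.
have s1 : s = 1 \/ s = -1.
  by have /eqP := s21; rewrite sqrf_eq1 => /orP[]/eqP; [left|right].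
apply: bernstein_slope => [i j ij|i j]; last first.
  have := reply_weight01 A k i e01; have := reply_weight01 A k j e01.
  by case: s1 => ->; lra.
have ijk : i%:R / k%:R <= j%:R / k%:R :> R.
  by rewrite ler_wpM2r ?invr_ge0// ler_nat.
have e1 : 0 <= 1 - eps by lra.
rewrite /reply_weight; case: s1 sA => ->; rewrite ?mul1r ?mulN1r => sA.
  rewrite lerD2r ler_wpM2l// best_reply_weight_homo//.
  by rewrite /advantage; move: sA ijk; rewrite /advantage_slope; nra.
rewrite lerN2 lerD2r ler_wpM2l// best_reply_weight_homo//.
by rewrite /advantage; move: sA ijk; rewrite /advantage_slope; nra.
Qed.

End TwoStrategies.

(** * Opposite incentives and the unique stationary point *)

Section Game22.
Context {R : realType}.
Implicit Types (A : 'M[R]_2) (G : game R 2 2) (eps u y : R).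

Lemma rV2P (p q : 'rV[R]_2) : p 0 0 = q 0 0 -> p 0 1 = q 0 1 -> p = q.
Proof.
move=> p0 p1; apply/rowP => i.
by have /orP[/eqP->|/eqP->] := ord2E i.
Qed.

Lemma advantageB A u y :
  advantage A u = advantage A y + (u - y) * advantage_slope A.
Proof. by rewrite /advantage /advantage_slope; ring. Qed.

(** The payoff is affine in the player's own first share, and an affine function with an interior
    maximum is constant. *)
Lemma best_reply_interior A (p q : 'rV[R]_2) : simplex p -> simplex q ->
  (forall s, 0 < p 0 s) ->
  (forall p', simplex p' -> expected_payoff A p' q <= expected_payoff A p q) ->
  advantage A (q 0 0) = 0.
Proof.
move=> sp sq p_gt0 pbr; have /simplex2P[_ p1] := sp.
have := pbr _ (simplex_unit_vector 0); have := pbr _ (simplex_unit_vector 1).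
rewrite !expected_payoff2//; [|exact: simplex_unit_vector..].
rewrite !(unit_vector2 _).1 /=; have := p_gt0 0; have := p_gt0 1; rewrite p1.
by move=> *; apply/eqP; rewrite eq_le; apply/andP; split; nra.
Qed.

Lemma best_reply_pure A (s : 'I_2) (q : 'rV[R]_2) : simplex q ->
  (if s == 0 then 0 <= advantage A (q 0 0) else advantage A (q 0 0) <= 0) ->
  forall p', simplex p' ->
    expected_payoff A p' q <= expected_payoff A (unit_vector s) q.
Proof.
move=> sq sA p' sp'; rewrite !expected_payoff2//; last exact: simplex_unit_vector.
rewrite !(unit_vector2 _).1 lerD2l.
by have /simplex2P[] := sp'; move: sA; case: ifP => _ /=; nra.
Qed.

(** Both advantages vanish at the mixed equilibrium, so each is its slope times the deviation. If
    both slopes are nonnegative, the pair of first strategies is a pure equilibrium; if both are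
    negative, first against second is one. Either contradicts uniqueness. *)
Lemma nash_opposite_slopes G :
  (exists x, unique (nash G) x /\ completely_mixed x) ->
  exists s : R, [/\ s ^+ 2 = 1, 0 <= s * advantage_slope (payoff1 G) &
                    0 <= - s * advantage_slope (payoff2 G)^T].
Proof.
move=> [x [[[[sx1 sx2] [br1 br2]] x_unique] [x1_gt0 x2_gt0]]].
have D1 := best_reply_interior sx1 sx2 x1_gt0 br1.
have D2 := best_reply_interior sx2 sx1 x2_gt0 br2.
have pure_nash (s t : 'I_2) :
    (if s == 0 then 0 <= advantage (payoff1 G) (t == 0)%:R
               else advantage (payoff1 G) (t == 0)%:R <= 0) ->
    (if t == 0 then 0 <= advantage (payoff2 G)^T (s == 0)%:R
               else advantage (payoff2 G)^T (s == 0)%:R <= 0) -> False.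
  rewrite -{1 2}(unit_vector2 t).1 -{1 2}(unit_vector2 s).1 => sbr tbr.
  have /x_unique xE : nash G (unit_vector s, unit_vector t).
    split; first by split; exact: simplex_unit_vector.
    split=> /=; apply: best_reply_pure => //; exact: simplex_unit_vector.
  have := x1_gt0 0; have := x1_gt0 1; rewrite xE /=.
  rewrite (unit_vector2 s).1 (unit_vector2 s).2.
  by have /orP[/eqP->|/eqP->] := ord2E s; rewrite /= ltxx.
have /simplex2P[_ x11] := sx1; have /simplex2P[_ x21] := sx2.
have := x1_gt0 0; have := x1_gt0 1; have := x2_gt0 0; have := x2_gt0 1.
rewrite x11 x21 => y1 y0 x1 x0.
have A1 u : advantage (payoff1 G) u = (u - x.2 0 0) * advantage_slope (payoff1 G).
  by rewrite (advantageB _ u (x.2 0 0)) D1 add0r.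
have A2 u : advantage (payoff2 G)^T u
    = (u - x.1 0 0) * advantage_slope (payoff2 G)^T.
  by rewrite (advantageB _ u (x.1 0 0)) D2 add0r.
have [d1|d1] := leP 0 (advantage_slope (payoff1 G));
  have [d2|d2] := leP 0 (advantage_slope (payoff2 G)^T).
- by exfalso; apply: (pure_nash 0 0); rewrite /= ?A1 ?A2 mulr_ge0//; lra.
- by exists 1; rewrite expr1n mul1r mulN1r; split=> //; lra.
- by exists (-1); rewrite sqrrN expr1n opprK mul1r mulN1r; split=> //; lra.
- exfalso; apply: (pure_nash 0 1); rewrite /= ?A1 ?A2.
    by rewrite mulr_le0 ?ltW//; lra.
  by rewrite mulr_ge0_le0 ?ltW//; lra.
Qed.

Lemma expected_replyE A k eps (q : 'rV[R]_2) i :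
  expected_reply A k eps q 0 i = reply_prob A k eps q i.
Proof.
rewrite /expected_reply summxE sum2 !mxE /=.
by have /orP[/eqP->|/eqP->] := ord2E i; rewrite /= ?mulr1 ?mulr0 ?addr0 ?add0r.
Qed.

Section Stationary.
Variables (G : game R 2 2) (k : nat) (eps s : R).
Hypotheses (k0 : (0 < k)%N) (e01 : 0 <= eps <= 1) (s2 : s ^+ 2 = 1).
Hypotheses (sA1 : 0 <= s * advantage_slope (payoff1 G))
           (sA2 : 0 <= - s * advantage_slope (payoff2 G)^T).

(** The sign makes both polynomials nondecreasing; multiplying by it once more recovers the reply
    probability. *)
Definition reply_poly1 :=
  bernstein k (fun j => s * reply_weight (payoff1 G) k eps j).
Definition reply_poly2 :=
  bernstein k (fun j => - s * reply_weight (payoff2 G)^T k eps j).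
Local Notation p := reply_poly1.
Local Notation q := reply_poly2.

Lemma reply_poly1_slope : slope_between (horner p) 0 k%:R.
Proof. exact: bernstein_reply_slope. Qed.

Lemma reply_poly2_slope : slope_between (horner q) 0 k%:R.
Proof. by apply: bernstein_reply_slope => //; rewrite sqrrN. Qed.

Lemma signed_bernstein t (phi : nat -> R) y : t ^+ 2 = 1 ->
  t * (bernstein k (fun j => t * phi j)).[y] = (bernstein k phi).[y].
Proof.
move=> t2; have := bernstein_affine k phi t 0 y.
have -> : (fun j => t * phi j + 0) = (fun j => t * phi j).
  by apply/funext => j; rewrite addr0.
by move=> ->; rewrite addr0 mulrA -expr2 t2 mul1r.
Qed.

Lemma reply_poly1E v : simplex v ->
  reply_prob (payoff1 G) k eps v 0 = s * p.[v 0 0] /\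
  reply_prob (payoff1 G) k eps v 1 = 1 - s * p.[v 0 0].
Proof. by rewrite signed_bernstein//; exact: reply_prob2. Qed.

Lemma reply_poly2E v : simplex v ->
  reply_prob (payoff2 G)^T k eps v 0 = - s * q.[v 0 0] /\
  reply_prob (payoff2 G)^T k eps v 1 = 1 - - s * q.[v 0 0].
Proof. by rewrite signed_bernstein ?sqrrN//; exact: reply_prob2. Qed.

Lemma reply_poly1_01 y : 0 <= y <= 1 -> 0 <= s * p.[y] <= 1.
Proof.
by move=> y01; rewrite signed_bernstein// bernstein01// => j; exact: reply_weight01.
Qed.

Lemma reply_poly2_01 y : 0 <= y <= 1 -> 0 <= - s * q.[y] <= 1.
Proof.
move=> y01; rewrite signed_bernstein ?sqrrN// bernstein01// => j.
exact: reply_weight01.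
Qed.

Lemma stationaryP (x : profile R 2 2) : mixed_profiles x ->
  stationary G k eps x <->
  x.1 0 0 = s * p.[x.2 0 0] /\ x.2 0 0 = - s * q.[x.1 0 0].
Proof.
move=> xmix; have [sx1 sx2] := xmix.
have /simplex2P[_ x11] := sx1; have /simplex2P[_ x21] := sx2.
have [p0 p1] := reply_poly1E sx2; have [q0 q1] := reply_poly2E sx1.
split=> [[_ [/subr0_eq e1 /subr0_eq e2]]|[e1 e2]].
  by rewrite -p0 -q0 -!expected_replyE e1 e2.
split=> //; rewrite /mean_field; congr pair; apply/eqP; rewrite subr_eq0; apply/eqP;
  apply: rV2P; rewrite expected_replyE ?p0 ?p1 ?q0 ?q1 ?x11 ?x21 //.
- by rewrite -e1.
- by rewrite -e2.
Qed.

(** Existence is the intermediate value theorem for the composed reply maps. For uniqueness, let [a]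
    and [b] be the differences of the first shares of two stationary points: monotonicity of the two
    polynomials gives [s a b >= 0] and [- s a b >= 0]. So one coordinate agrees, and the
    stationarity equations carry this to the other. *)
Lemma stationary_unique_exists : exists x, unique (stationary G k eps) x.
Proof.
have [|x /andP[x0 x1]] :=
    @poly_ivt _ ('X - ((s *: p) \Po (- s *: q))) 0 1 ler01.
  rewrite !(hornerE, horner_comp).
  have o1 : 0 <= (1 : R) <= 1 by rewrite ler01 lexx.
  have z1 : 0 <= (0 : R) <= 1 by rewrite ler01 lexx.
  have := reply_poly1_01 (reply_poly2_01 o1).
  have := reply_poly1_01 (reply_poly2_01 z1).
  by lra.
rewrite /root !(hornerE, horner_comp) subr_eq0 => /eqP xE.
have x01 : 0 <= x <= 1 by rewrite x0.
pose mk u : 'rV[R]_2 := \row_j (if j == 0 then u else 1 - u).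
have smk u : 0 <= u <= 1 -> simplex (mk u).
  by move=> u01; apply/simplex2P; rewrite !mxE.
pose z : profile R 2 2 := (mk x, mk (- s * q.[x])).
have zmix : mixed_profiles z by split; apply: smk => //; exact: reply_poly2_01.
have zst : stationary G k eps z.
  by apply/stationaryP => //; rewrite !mxE.
exists z; split=> // y yst; have [ymix _] := yst.
have /stationaryP -/(_ ymix)[y1 y2] := yst.
have /stationaryP -/(_ zmix)[z1 z2] := zst.
have [/simplex2P[y101 y11] /simplex2P[y201 y21]] := ymix.
have [/simplex2P[z101 z11] /simplex2P[z201 z21]] := zmix.
have P0 := slope_between_monotone reply_poly1_slope z201 y201.
have Q0 := slope_between_monotone reply_poly2_slope z101 y101.
have aE : y.1 0 0 - z.1 0 0 = s * (p.[y.2 0 0] - p.[z.2 0 0]).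
  by rewrite y1 z1 mulrBr.
have bE : y.2 0 0 - z.2 0 0 = - s * (q.[y.1 0 0] - q.[z.1 0 0]).
  by rewrite y2 z2 mulrBr.
have ab : (y.1 0 0 - z.1 0 0) * (y.2 0 0 - z.2 0 0) = 0.
  apply/eqP; rewrite -sqrf_eq0 -[_ ^+ 2]mul1r.
  have F : p.[y.2 0 0] - p.[z.2 0 0] = s * (y.1 0 0 - z.1 0 0).
    by rewrite aE mulrA -expr2 s2 mul1r.
  have H : q.[y.1 0 0] - q.[z.1 0 0] = - s * (y.2 0 0 - z.2 0 0).
    by rewrite bE mulrA -expr2 sqrrN s2 mul1r.
  move: P0 Q0; rewrite F H => P0 Q0.
  have sab : s * ((y.1 0 0 - z.1 0 0) * (y.2 0 0 - z.2 0 0)) = 0 by lra.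
  by rewrite -s2 -exprMn sab expr0n.
have yz1 : y.1 0 0 = z.1 0 0.
  move/eqP: ab; rewrite mulf_eq0 !subr_eq0 => /orP[/eqP //|/eqP y2z2].
  by rewrite y1 y2z2 -z1.
have yz2 : y.2 0 0 = z.2 0 0 by rewrite y2 yz1 -z2.
rewrite [LHS]surjective_pairing [RHS]surjective_pairing.
by congr pair; apply: rV2P => //; rewrite ?z11 ?z21 ?y11 ?y21 ?yz1 ?yz2.
Qed.

End Stationary.
End Game22.

(** * Drift conditions and invariant measures *)

Section InvariantMeasure.
Context d (T : measurableType d) (R : realType) (mu : probability T R) (D : set T).
Context (I : finType) (w : I -> T -> R) (g : I -> T -> T).
Hypotheses (mD : measurable D) (muD : mu D = 1%E).
Hypothesis mw : forall i, measurable_fun D (w i).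
Hypothesis mg : forall i, measurable_fun D (g i).
Hypothesis w0 : forall i x, D x -> 0 <= w i x.

(* The transition operator of the chain that moves from [x] to [g i x] with
   probability [w i x]. *)
Definition transfer (V : T -> R) (x : T) : R := \sum_i w i x * V (g i x).

Hypothesis mu_inv : forall U : set T, measurable U ->
  mu U = (\int[mu]_(x in D) (transfer \1_U x)%:E)%E.

Import HBNNSimple.

Lemma measurable_transfer (V : T -> R) : measurable_fun setT V ->
  measurable_fun D (EFin \o transfer V).
Proof.
move=> mV; apply/measurable_EFinP; apply: measurable_sum => i.
by apply: measurable_funM => //; exact: measurableT_comp.
Qed.

Lemma transfer_ge0 (V : T -> R) x : (forall y, 0 <= V y) -> D x ->
  0 <= transfer V x.
Proof. by move=> V0 Dx; apply: sumr_ge0 => i _; rewrite mulr_ge0// w0. Qed.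

(** Invariance is given on indicators; linearity extends it to nonnegative simple functions. *)
Lemma integral_transfer_nnsfun (f : {nnsfun T >-> R}) :
  (\int[mu]_x (f x)%:E = \int[mu]_(x in D) (transfer f x)%:E)%E.
Proof.
rewrite integralT_nnsfun sintegralE fsbig_finite//=; set s := finmap.enum_fset _.
have fE y : f y = \sum_(r <- s) r * \1_(f @^-1` [set r]) y.
  by rewrite fimfunE fsbig_finite.
have mf r : measurable (f @^-1` [set r]) by exact: measurable_sfunP.
have tE x : (transfer f x)%:E =
    (\sum_(r <- s) (r * transfer \1_(f @^-1` [set r]) x)%:E)%E.
  rewrite sumEFin; congr _%:E; rewrite /transfer.
  under eq_bigr do rewrite fE mulr_sumr.
  rewrite exchange_big; apply: eq_bigr => r _.
  by rewrite mulr_sumr; apply: eq_bigr => i _; rewrite mulrCA.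
under [RHS]eq_integral do rewrite tE.
have m1 r : measurable_fun D (EFin \o transfer \1_(f @^-1` [set r])).
  exact: measurable_transfer.
have t0 r x : D x -> 0 <= transfer \1_(f @^-1` [set r]) x.
  by apply: transfer_ge0.
rewrite ge0_integral_sum//; first last.
(* For negative [r] the fibre of the nonnegative [f] is empty, so the term is zero. *)
- move=> r x Dx; rewrite lee_fin; have [r0|r0] := leP 0 r.
    by rewrite mulr_ge0// t0.
  rewrite /transfer big1 ?mulr0// => i _.
  by rewrite preimage_nnfun0// indic0 mulr0.
- move=> r; apply/measurable_EFinP; apply: measurable_funM => //.
  exact/measurable_EFinP.
apply: eq_bigr => r _; rewrite mu_inv//.
have [r0|r0] := leP 0 r.
  under [RHS]eq_integral do rewrite EFinM.
  rewrite ge0_integralZl//; first exact: m1.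
  by move=> x Dx; rewrite lee_fin t0.
have z x : transfer \1_(f @^-1` [set r]) x = 0.
  by rewrite /transfer big1// => i _; rewrite preimage_nnfun0// indic0 mulr0.
by rewrite !integral0_eq ?mule0// => x _; rewrite z ?mulr0.
Qed.

(** Monotone convergence along simple functions below [V]. An inequality suffices for the drift
    argument and avoids a limit on the right. *)
Lemma integral_le_transfer (V : T -> R) : measurable_fun setT V ->
  (forall x, 0 <= V x) ->
  (\int[mu]_x (V x)%:E <= \int[mu]_(x in D) (transfer V x)%:E)%E.
Proof.
move=> mV V0; have mEV : measurable_fun setT (EFin \o V) by exact/measurable_EFinP.
pose f n := nnsfun_approx measurableT mEV n.
have EV0 x : setT x -> (0 <= (EFin \o V) x)%E by rewrite lee_fin.
have -> : (\int[mu]_x (V x)%:E = \int[mu]_x (limn (fun n => (f n x)%:E)))%E.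
  apply: eq_integral => x _; apply/esym/cvg_lim => //.
  exact: (cvg_nnsfun_approx measurableT mEV EV0).
have mf n : measurable_fun setT (EFin \o f n) by exact/measurable_EFinP.
have f_nd x m n : (m <= n)%N -> ((f m x)%:E <= (f n x)%:E)%E.
  by move=> mn; rewrite lee_fin; exact/lefP/nd_nnsfun_approx.
have f0 n x : setT x -> (0 <= (f n x)%:E)%E by rewrite lee_fin.
rewrite monotone_convergence//; last by move=> x _ m n; exact: f_nd.
apply: lime_le.
  apply/cvg_ex; eexists.
  by apply: cvg_monotone_convergence => // x _ m n; exact: f_nd.
apply: nearW => n; rewrite integral_transfer_nnsfun; apply: ge0_le_integral => //.
- by move=> x Dx; rewrite lee_fin transfer_ge0.
- exact: measurable_transfer.
- exact: measurable_transfer.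
- move=> x Dx; rewrite lee_fin ler_sum// => i _; rewrite ler_wpM2l ?w0//.
  rewrite -lee_fin nnsfun_approxE; exact: le_approx.
Qed.

(** Invariance and drift give [v <= rho v + b] for the integral [v] of [V] over [D]. The bound [C]
    makes [v] finite, so that [rho v] can be subtracted; Markov's inequality then applies. The value
    of [C] does not enter the conclusion. *)
Lemma invariant_measure_markov (V : T -> R) (rho b c C : R) (B : set T) :
  measurable_fun setT V -> (forall x, 0 <= V x) ->
  (forall x, D x -> V x <= C) -> 0 <= rho < 1 -> 0 <= b -> 0 < c ->
  (forall x, D x -> transfer V x <= rho * V x + b) ->
  measurable B -> B `<=` D -> (forall x, B x -> c <= V x) ->
  fine (mu B) <= b / (1 - rho) / c.
Proof.
move=> mV V0 VC /andP[rho0 rho1] b0 c0 drift mB BD cV.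
have mEV S : measurable_fun S (EFin \o V).
  by apply/measurable_EFinP; exact: measurable_funS mV.
have EV0 S x : S x -> (0 <= (V x)%:E)%E by rewrite lee_fin.
set v := (\int[mu]_(x in D) (V x)%:E)%E.
have v0 : (0 <= v)%E by apply: integral_ge0; exact: EV0.
have vC : (v <= C%:E)%E.
  rewrite -[leRHS]mule1 -muD -integral_cst//; apply: ge0_le_integral => //.
  exact: EV0.
have vfin : v \is a fin_num by rewrite ge0_fin_numE// (le_lt_trans vC)// ltry.
have vdrift : (v <= rho%:E * v + b%:E)%E.
  apply: (@le_trans _ _ (\int[mu]_x (V x)%:E)%E).
    by apply: ge0_subset_integral => //; exact: EV0.
  apply: le_trans (integral_le_transfer mV V0) _.
  rewrite -[b%:E]mule1 -muD -integral_cst// -ge0_integralZl//; last exact: EV0.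
  rewrite -ge0_integralD//.
  - apply: ge0_le_integral => //.
    + by move=> x Dx; rewrite lee_fin transfer_ge0.
    + exact: measurable_transfer.
    + by apply: emeasurable_funD => //; exact: measurable_funeM.
  - by move=> x Dx; rewrite mule_ge0 ?lee_fin.
  - exact: measurable_funeM.
have muBv : (c%:E * mu B <= v)%E.
  rewrite -integral_cst//; apply: (@le_trans _ _ (\int[mu]_(x in B) (V x)%:E)%E).
    by apply: ge0_le_integral => // x Bx; rewrite lee_fin ?(ltW c0)// cV.
  by apply: ge0_subset_integral => //; exact: EV0.
have muBfin : mu B \is a fin_num by exact: fin_num_measure.
move: vdrift muBv; rewrite -(fineK vfin) -(fineK muBfin).
rewrite -!EFinM -EFinD !lee_fin => vd cB.
rewrite ler_pdivlMr// ler_pdivlMr ?subr_gt0// mulrC [fine _ * c]mulrC.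
have : (1 - rho) * (c * fine (mu B)) <= (1 - rho) * fine v.
  by rewrite ler_wpM2l// subr_ge0 ltW.
lra.
Qed.

End InvariantMeasure.

(** * Measurability and distance on the space of profiles *)

Section BorelProfile.
Context {R : realType}.
Local Notation T := (borel_profile R 2 2).

Lemma continuous_borel_profile (f : profile R 2 2 -> R) : continuous f ->
  measurable_fun [set: T] f.
Proof.
move=> /continuousP cf; apply: (measurability _ (RGenOpens.measurableE R)).
move=> _ [_ [a [b ->] <-]]; rewrite setTI; apply: sub_sigma_algebra.
by apply: cf; exact: interval_open.
Qed.

Lemma continuous_borel_profile_map (f : profile R 2 2 -> profile R 2 2) :
  continuous f -> measurable_fun [set: T] (f : T -> T).
Proof.
move=> /continuousP cf; apply: (@measurability _ _ T T _ f (@open (profile R 2 2)) erefl).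
by move=> _ [U oU <-]; rewrite setTI; apply: sub_sigma_algebra; exact: cf.
Qed.

Lemma continuous_profile1 i : continuous (fun x : profile R 2 2 => x.1 0 i : R).
Proof.
move=> x; apply: (@continuous_comp _ _ _ fst (fun M : 'rV_2 => M 0 i)).
  exact: cvg_fst.
exact: coord_continuous.
Qed.

Lemma continuous_profile2 i : continuous (fun x : profile R 2 2 => x.2 0 i : R).
Proof.
move=> x; apply: (@continuous_comp _ _ _ snd (fun M : 'rV_2 => M 0 i)).
  exact: cvg_snd.
exact: coord_continuous.
Qed.

Lemma measurable_profile1 i : measurable_fun [set: T] (fun x : T => x.1 0 i : R).
Proof. exact: (continuous_borel_profile (@continuous_profile1 i)). Qed.

Lemma measurable_profile2 i : measurable_fun [set: T] (fun x : T => x.2 0 i : R).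
Proof. exact: (continuous_borel_profile (@continuous_profile2 i)). Qed.

Lemma measurable_rws_next beta s1 s2 :
  measurable_fun [set: T] (fun x : T => rws_next beta x s1 s2).
Proof.
pose f1 (x : profile R 2 2) := beta *: x.1 + (1 - beta) *: unit_vector s1.
pose f2 (x : profile R 2 2) := beta *: x.2 + (1 - beta) *: unit_vector s2.
apply: (@continuous_borel_profile_map (fun x => (f1 x, f2 x))) => x.
apply: (@cvg_pair _ _ _ _ (nbhs (f1 x)) (nbhs (f2 x)) _ _ _ f1 f2).
  by apply: cvgD; [apply: cvgZr; exact: cvg_fst|exact: cvg_cst].
by apply: cvgD; [apply: cvgZr; exact: cvg_snd|exact: cvg_cst].
Qed.

Lemma measurable_le_profile (f g : T -> R) : measurable_fun setT f ->
  measurable_fun setT g -> measurable [set x | f x <= g x].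
Proof.
by move=> mf mg; rewrite -[X in measurable X]setTI; exact: measurable_fun_le.
Qed.

Lemma measurable_mixed_profiles : measurable (@mixed_profiles R 2 2 : set T).
Proof.
have m1 := measurable_profile1; have m2 := measurable_profile2.
have meq (f g : T -> R) : measurable_fun setT f -> measurable_fun setT g ->
    measurable [set x | f x = g x].
  move=> mf mg.
  rewrite (_ : [set x | _] = [set x | f x <= g x] `&` [set x | g x <= f x]).
    by apply: measurableI; exact: measurable_le_profile.
  apply/seteqP; split=> x /=; first by move=> ->.
  by move=> [fg gf]; apply/eqP; rewrite eq_le fg.
rewrite (_ : mixed_profiles =
  ([set x : T | 0 <= x.1 0 0] `&` [set x : T | x.1 0 0 <= 1] `&`
   [set x : T | x.1 0 1 = 1 - x.1 0 0]) `&`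
  ([set x : T | 0 <= x.2 0 0] `&` [set x : T | x.2 0 0 <= 1] `&`
   [set x : T | x.2 0 1 = 1 - x.2 0 0])).
  by do ![apply: measurableI]; first [apply: meq|apply: measurable_le_profile] => //;
    try exact: measurable_cst; apply: measurable_funB.
apply/seteqP; split=> x /=.
  by move=> [/simplex2P[/andP[? ?] ?] /simplex2P[/andP[? ?] ?]].
move=> [[[? ?] ?] [[? ?] ?]].
by split; apply/simplex2P; split=> //; apply/andP.
Qed.

Lemma measurable_profile_dist_ge (eta : R) (z : profile R 2 2) :
  measurable ([set x | mixed_profiles x /\ eta <= `|x - z|] : set T).
Proof.
apply: measurableI; first exact: measurable_mixed_profiles.
apply: measurable_le_profile => //.
apply: (@continuous_borel_profile (fun x => `|x - z|)) => x.
by apply: cvg_norm; apply: cvgB; [exact: cvg_id|exact: cvg_cst].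
Qed.

(** On the simplex both coordinates of a difference have the same absolute value, so the norm only
    sees the first shares. *)
Lemma profile_dist_sqr (x z : profile R 2 2) : mixed_profiles x ->
  mixed_profiles z ->
  `|x - z| ^+ 2 <= (x.1 0 0 - z.1 0 0) ^+ 2 + (x.2 0 0 - z.2 0 0) ^+ 2.
Proof.
have row_dist (u v : 'rV[R]_2) : simplex u -> simplex v ->
    `|u - v| <= `|u 0 0 - v 0 0|.
  move=> /simplex2P[_ u1] /simplex2P[_ v1]; rewrite [leLHS]mx_normrE.
  apply: bigmax_le => // -[i j] _; rewrite !mxE (ord1 i) /=.
  have /orP[/eqP->|/eqP->] := ord2E j => //.
  by rewrite u1 v1 opprB addrCA addrAC subrr add0r -normrN opprB addrC lexx.
move=> [x1 x2] [z1 z2]; have d1 := row_dist _ _ x1 z1; have d2 := row_dist _ _ x2 z2.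
have sq (u v : R) : 0 <= u -> u <= `|v| -> u ^+ 2 <= v ^+ 2.
  by move=> u0 uv; rewrite -(real_normK (num_real v)) ler_sqr ?nnegrE.
rewrite prod_normE /Order.max; case: ifP => _.
  by rewrite -[leLHS]add0r lerD ?sqr_ge0// sq.
by rewrite -[leLHS]addr0 lerD ?sqr_ge0// sq.
Qed.

End BorelProfile.

(** With [u = lam eta^2 / (4 h)], the second divisor is [exp(u)^2]. One factor [exp(-u) <= 1 / u]
    pays for the [2 / (lam h)] coming from the first divisor, and the other remains as the decay. *)
Lemma expRN_decay_bound (R : realType) (lam h eta b : R) :
  0 < lam <= 4^-1 -> 0 < h <= 1 -> 0 < eta -> 0 <= b ->
  b / (1 - expR (- (lam * h))) / expR (lam / h * (eta ^+ 2 / 2)) <=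
  8 * b / (lam ^+ 2 * eta ^+ 2) * expR (- (lam / 4 * eta ^+ 2 / h)).
Proof.
move=> /andP[l0 l1] /andP[h0 h1] eta0 b0.
have lh0 : 0 < lam * h by rewrite mulr_gt0.
have lh : lam * h <= 4^-1 by rewrite (le_trans _ l1)// ler_piMr// ltW.
have den : lam * h / 2 <= 1 - expR (- (lam * h)).
  have : - (lam * h) <= 2^-1 by lra.
  by move=> /expR_le1DxDsqr; rewrite sqrrN; nra.
set u := lam / 4 * eta ^+ 2 / h.
have u0 : 0 < u by rewrite !mulr_gt0 ?invr_gt0 ?exprn_gt0.
have -> : lam / h * (eta ^+ 2 / 2) = u + u by rewrite /u; field; rewrite gt_eqF.
rewrite expRD invfM -expRN.
have uN : expR (- u) <= u^-1.
  by rewrite expRN lef_pV2 ?posrE ?expR_gt0// (le_trans _ (expR_ge1Dx _))// lerDr.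
rewrite mulrA ler_pM2r ?expR_gt0//.
apply: (@le_trans _ _ (b / (lam * h / 2) * u^-1)).
  apply: ler_pM => //; rewrite ?expR_ge0//.
    by rewrite divr_ge0// (le_trans _ den)// divr_ge0// ltW.
  by rewrite ler_wpM2l// lef_pV2 ?posrE ?divr_gt0// (lt_le_trans _ den)// divr_gt0.
rewrite le_eqVlt; apply/orP; left; apply/eqP.
by rewrite /u; field; rewrite !gt_eqF.
Qed.

(** * The tail bound for the sampler *)

Section Concentration.
Context {R : realType}.
Variables (G : game R 2 2) (k : nat) (eps s : R).
Hypotheses (k0 : (0 < k)%N) (e01 : 0 <= eps <= 1) (s2 : s ^+ 2 = 1).
Hypotheses (sA1 : 0 <= s * advantage_slope (payoff1 G))
           (sA2 : 0 <= - s * advantage_slope (payoff2 G)^T).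
Local Notation T := (borel_profile R 2 2).

Definition rws_weight (i : 'I_2 * 'I_2) (x : T) : R :=
  reply_prob (payoff1 G) k eps x.2 i.1 * reply_prob (payoff2 G)^T k eps x.1 i.2.

Local Notation w1 x := (s * (reply_poly1 G k eps s).[x.2 0 0]).
Local Notation w2 x := (- s * (reply_poly2 G k eps s).[x.1 0 0]).

Lemma rws_weightE i x : mixed_profiles x -> rws_weight i x =
  (if i.1 == 0 then w1 x else 1 - w1 x) * (if i.2 == 0 then w2 x else 1 - w2 x).
Proof.
case: i => i1 i2 [sx1 sx2]; rewrite /rws_weight /=.
have [p0 p1] := @reply_poly1E R G k eps s k0 s2 _ sx2.
have [q0 q1] := @reply_poly2E R G k eps s k0 s2 _ sx1.
have /orP[/eqP->|/eqP->] := ord2E i1; have /orP[/eqP->|/eqP->] := ord2E i2;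
  by rewrite ?p0 ?p1 ?q0 ?q1.
Qed.

Lemma rws_weight_ge0 i x : mixed_profiles x -> 0 <= rws_weight i x.
Proof.
move=> xmix; rewrite rws_weightE//; have [/simplex2P[x1 _] /simplex2P[x2 _]] := xmix.
have /andP[? ?] := reply_poly1_01 G k e01 s2 x2.
have /andP[? ?] := reply_poly2_01 G k e01 s2 x1.
by rewrite mulr_ge0//; case: ifP; rewrite ?subr_ge0.
Qed.

Lemma measurable_rws_weight i :
  measurable_fun (mixed_profiles : set T) (rws_weight i).
Proof.
have mw1 : measurable_fun [set: T] (fun x : T => w1 x).
  apply: measurable_funM => //.
  exact (measurableT_comp (@measurable_poly R _ setT) (@measurable_profile2 R 0)).
have mw2 : measurable_fun [set: T] (fun x : T => w2 x).
  apply: measurable_funM => //.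
  exact (measurableT_comp (@measurable_poly R _ setT) (@measurable_profile1 R 0)).
apply: (eq_measurable_fun (fun x : T => (if i.1 == 0 then w1 x else 1 - w1 x) *
    (if i.2 == 0 then w2 x else 1 - w2 x))).
  by move=> x /set_mem xmix; rewrite rws_weightE.
apply: measurable_funTS; case: (i.1 == 0); case: (i.2 == 0);
  apply: measurable_funM => //; exact: measurable_funB.
Qed.

Lemma rws_transitionE beta x (U : set T) :
  rws_transition G k eps beta x U =
  (transfer rws_weight (fun i x => rws_next beta x i.1 i.2) \1_U x)%:E.
Proof.
rewrite /rws_transition /transfer -sumEFin.
rewrite -(pair_big xpredT xpredT (fun i j => (rws_weight (i, j) x *
    \1_U (rws_next beta x i j))%:E)) /=.
by apply: eq_bigr => i _; apply: eq_bigr => j _; rewrite EFinM diracE.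
Qed.

Lemma rws_concentration beta (mu : probability T R) (z : profile R 2 2) (eta : R)
    (lam := lyapunov_rate k%:R) :
  0 <= beta < 1 -> rws_invariant G k eps beta mu -> stationary G k eps z ->
  0 < eta ->
  fine (mu [set x | mixed_profiles x /\ eta <= `|x - z|]) <=
  8 * expR (lam * (4 * (1 + k%:R ^+ 2) * ((1 + k%:R ^+ 2) + 1)))
    / (lam ^+ 2 * eta ^+ 2) * expR (- (lam / 4 * eta ^+ 2 / (1 - beta))).
Proof.
move=> b01 [mu1 muinv] zst eta0; have /andP[b0 b1] := b01.
have [zmix _] := zst.
have [z1E z2E] := (@stationaryP R G k eps s k0 s2 z zmix).1 zst.
have [/simplex2P[z101 _] /simplex2P[z201 _]] := zmix.
have [P PE] := poly_antiderivative (reply_poly1 G k eps s).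
have [Q QE] := poly_antiderivative (reply_poly2 G k eps s).
have pL : slope_between (horner P^`()) 0 k%:R.
  by rewrite PE; exact: reply_poly1_slope.
have qL : slope_between (horner Q^`()) 0 k%:R.
  by rewrite QE; exact: reply_poly2_slope.
rewrite -PE -QE in z1E z2E.
pose W := lyapunov_exp P Q k%:R (z.1 0 0) (z.2 0 0) beta.
pose V (x : T) : R := W (x.1 0 0) (x.2 0 0).
set h := 1 - beta.
have h0 : 0 < h by rewrite subr_gt0.
have lam0 : 0 < lam by rewrite invr_gt0 mulr_gt0// exprn_gt0// ltr_pwDl// sqr_ge0.
have lam4 : lam <= 4^-1.
  have := sqr_ge0 (k%:R : R).
  rewrite lef_pV2 ?posrE ?mulr_gt0 ?exprn_gt0 ?ltr_pwDl ?sqr_ge0//.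
  by nra.
set b := expR _.
apply: le_trans (expRN_decay_bound (lam := lam) (h := h) _ _ eta0 _) => //;
  rewrite ?expR_ge0 ?lam0 ?h0//=; last by rewrite /h; lra.
have rho01 : 0 <= expR (- (lam * h)) < 1.
  by rewrite expR_ge0 expR_lt1 oppr_lt0 mulr_gt0.
(* The bound on [V] comes from [r2 <= 2]. On the tail event [lyapunov] is at least [eta^2 / 2],
   which yields the level [expR (lam / h * (eta ^+ 2 / 2))]. The Lipschitz constant is the sample
   size. *)
apply: (@invariant_measure_markov _ T R mu mixed_profiles _ rws_weight
  (fun i x => rws_next beta x i.1 i.2) measurable_mixed_profiles mu1
  measurable_rws_weight _ rws_weight_ge0 _ V _ b _
  (expR (lam / h * ((1 + k%:R ^+ 2) * 2)))) => //; rewrite ?expR_ge0 ?expR_gt0//.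
- by move=> i; apply: measurable_funTS; exact: measurable_rws_next.
- move=> U mU; rewrite muinv//.
  by apply: eq_integral => x _; rewrite rws_transitionE.
- have mbreg S u (f : T -> R) : measurable_fun setT f ->
      measurable_fun setT (fun x => bregman S u (f x)).
    move=> mf; apply: measurable_funB.
      apply: measurable_funB => //.
      exact (measurableT_comp (@measurable_poly R _ setT) mf).
    by apply: measurable_funM => //; exact: measurable_funB.
  have m1 := measurable_profile1 (0 : 'I_2).
  have m2 := measurable_profile2 (0 : 'I_2).
  suff mW : measurable_fun [set: T] (fun x : T => lam / h *
      lyapunov P Q k%:R (z.1 0 0) (z.2 0 0) (x.1 0 0) (x.2 0 0)).
    exact (measurableT_comp (@measurable_expR R) mW).
  apply: measurable_funM => //; apply: measurable_funD.
    by apply: measurable_funM => //; apply: measurable_funD;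
      apply: measurable_funX; exact: measurable_funB.
  by apply: measurable_funM => //; apply: measurable_funD; exact: mbreg.
- by move=> x; exact: expR_ge0.
- move=> x [/simplex2P[x101 _] /simplex2P[x201 _]].
  rewrite ler_expR ler_pM2l ?divr_gt0//.
  have /andP[_ Wk] := lyapunov_ge_le pL qL z101 z201 x101 x201.
  apply: (le_trans Wk); rewrite ler_pM2l ?ltr_pwDl ?sqr_ge0//.
  by have := sqrB_le1 x101 z101; have := sqrB_le1 x201 z201; lra.
- move=> x xmix; have [/simplex2P[x101 _] /simplex2P[x201 _]] := xmix.
  have w101 := reply_poly1_01 G k e01 s2 x201.
  have w201 := reply_poly2_01 G k e01 s2 x101.
  have := lyapunov_exp_drift pL qL s2 z1E z2E z101 z201 b01 x101 x201.
  rewrite PE QE => /(_ w101 w201); apply: le_trans.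
  (* The sum over pairs of pure strategies unfolds to the four-term average of [lyapunov_exp_drift],
     with new first shares pulled towards 1 or 0. *)
  rewrite /transfer -(pair_big xpredT xpredT (fun i j => rws_weight (i, j) x *
    V (rws_next beta x i j))) /= !sum2 !rws_weightE//=.
  by rewrite /V /rws_next /= !mxE /= !mulr1 !mulr0.
- exact: measurable_profile_dist_ge.
- by move=> x [].
- move=> x [xmix xz]; have [/simplex2P[x101 _] /simplex2P[x201 _]] := xmix.
  have /andP[Wr _] := lyapunov_ge_le pL qL z101 z201 x101 x201.
  rewrite ler_expR ler_pM2l ?divr_gt0// (le_trans _ Wr)// ler_pM2r//.
  apply: le_trans (profile_dist_sqr xmix zmix).
  by rewrite ler_sqr ?nnegrE ?(ltW eta0)// (le_trans _ xz)// ltW.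
Qed.


End Concentration.

Theorem theorem6 (R : realType) (G : game R 2 2) (k : nat) (k_ge1 : (1 <= k)%N)
    (G_nash : exists x : profile R 2 2, unique (nash G) x /\ completely_mixed x) :
  exists K : R, 0 < K /\
    forall eps : R, 0 < eps <= 1 ->
    exists xstar : profile R 2 2, unique (stationary G k eps) xstar /\
      forall mu : R -> probability (borel_profile R 2 2) R,
      (forall beta : R, 2^-1 < beta < 1 ->
         rws_unique_invariant G k eps beta (mu beta)) ->
      forall eta : R, 0 < eta ->
        (fun beta : R => fine (mu beta
           [set x : profile R 2 2 | mixed_profiles x /\ eta <= `|x - xstar|]))
        =O_one_left (fun beta : R => expR (- (K * eta ^+ 2 / (1 - beta)))).
Proof.
have [s [s2 sA1 sA2]] := nash_opposite_slopes G_nash.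
have lam0 : 0 < lyapunov_rate (k%:R : R).
  by rewrite invr_gt0 mulr_gt0// exprn_gt0// ltr_pwDl// sqr_ge0.
(* This rate depends on the sample size alone; a further dependence on [eta] goes into the constant
   of the big O. *)
exists (lyapunov_rate (k%:R : R) / 4); split; first by rewrite divr_gt0.
move=> eps /andP[/ltW e0 e1]; have e01 : 0 <= eps <= 1 by rewrite e0.
have [z zst] := stationary_unique_exists k_ge1 e01 s2 sA1 sA2.
exists z; split=> // mu mu_inv eta eta0; apply/eqO_exP.
exists (8 * expR (lyapunov_rate (k%:R : R) *
          (4 * (1 + k%:R ^+ 2) * ((1 + k%:R ^+ 2) + 1)))
    / (lyapunov_rate (k%:R : R) ^+ 2 * eta ^+ 2)).
  by rewrite divr_gt0 ?mulr_gt0 ?expR_gt0 ?exprn_gt0.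
near=> beta.
have b1 : beta < 1 by near: beta; exact: nbhs_left_lt.
have b2 : 2^-1 < beta by near: beta; apply: nbhs_left_gt; lra.
have b01 : 0 <= beta < 1 by rewrite b1 andbT; lra.
have [mu_b _] := mu_inv beta (introT andP (conj b2 b1)).
rewrite ger0_norm ?fine_ge0// [X in _ <= _ * X]ger0_norm ?expR_ge0//.
exact: (rws_concentration k_ge1 e01 s2 sA1 sA2 b01 mu_b zst.1 eta0).
Unshelve. all: by end_near.
Qed.
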